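(* Let $n=2^{s}$ and $q=2^{r}$ with $s,r$ positive integers. Then for every positive integer $h$, \[ q^{\binom{n}{2}h}MK_{n-1}^{h}=\sum_{i=0}^{h-1}(-1)^{h+i+1}\binom{h}{i}N^{h-i}q^{\binom{n}{2}i}MK_{n-1}^{i} +q\sum_{i=0}^{\min\{N,h\}}(-1)^{h+i}C_{i}\sum_{t=i}^{h}t!\,S(h,t)\,2^{h-t}\binom{N-i}{N-t}, \] where $N=q^{\binom{n}{2}}\prod_{j=2}^{n}(q^{j}-1)$ is the order of $SL(n,q)$, $S(h,t)=\frac{1}{t!}\sum_{j=0}^{t}(-1)^{t-j}\binom{t}{j}j^{h}$ is the Stirling number of the second kind, and $\{C_i\}_{i=0}^{N}$ is the weight distribution of the code $C=C(SL(n,q))$. Moreover, for $0\le i\le N$, \[ C_{i}=\sum\prod_{\beta\in\mathbb{F}_{q}}\binom{n_{\beta}}{\nu_{\beta}}, \] where the sum runs over all families of nonnegative integers $\{\nu_\beta\}_{\beta\in\mathbb{F}_q}$ with $\sum_{\beta}\nu_\beta=i$ and $\sum_{\beta}\nu_\beta\beta=0$ (an identity in $\mathbb{F}_q$), and \[ n_\beta=|\{g\in SL(n,q): Tr(g)=\beta\}|=q^{\binom{n}{2}-1}\Big\{\prod_{j=2}^{n}(q^{j}-1)+1+q\,\theta(\beta)\Big\},\qquad \theta(\beta)=\begin{cases}K_{n-2}(\lambda;\beta^{-1}),&\beta\neq0,\\ 0,&\beta=0.\end{cases} \]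
   Context: $\mathbb{F}_q$ is the finite field with $q$ elements, $tr(x)=x+x^2+\cdots+x^{2^{r-1}}$ is the absolute trace $\mathbb{F}_q\to\mathbb{F}_2$, and $\lambda(x)=(-1)^{tr(x)}$ is the canonical additive character. For a positive integer $m$ and $a\in\mathbb{F}_q^*$, the $m$-dimensional Kloosterman sum is $K_m(\lambda;a)=\sum_{\alpha_1,\dots,\alpha_m\in\mathbb{F}_q^*}\lambda(\alpha_1+\cdots+\alpha_m+a\alpha_1^{-1}\cdots\alpha_m^{-1})$; by convention $K_0(\lambda;a)=\lambda(a)$. The $h$-th moment is $MK_m^{h}=\sum_{a\in\mathbb{F}_q^*}K_m(\lambda;a)^h$ (so $MK_m^0=q-1$). $Tr(g)$ denotes the matrix trace. Fix an ordering $g_1,\dots,g_N$ of $SL(n,q)$ and let $v=(Tr(g_1),\dots,Tr(g_N))\in\mathbb{F}_q^N$; the binary code is $C(SL(n,q))=\{u\in\mathbb{F}_2^N: u\cdot v=0\}$ (dot product computed in $\mathbb{F}_q$). $C_i$ is the number of codewords of Hamming weight $i$ in this code. Convention: $\binom{b}{a}=0$ if $b<a$. *)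

(* Defs.v *)
From HB Require Import structures.
From mathcomp Require Import all_boot all_order all_algebra.
Set Implicit Arguments. Unset Strict Implicit. Unset Printing Implicit Defensive.
Import Order.TTheory GRing.Theory Num.Theory.
Local Open Scope ring_scope.

Section Defs.
Variables (F : finFieldType) (r : nat).

(* absolute trace F_q -> F_2 (values in {0,1} of F), q = 2^r *)
Definition abstr (x : F) : F := \sum_(k < r) x ^+ (2 ^ k)%N.

Definition lam (x : F) : int := if abstr x == 0 then 1 else -1.

(* m-dimensional Kloosterman sum K_m(lambda; a); for m = 0 the sum is over the
   unique empty family and equals lam a, matching the convention. *)
Definition Kloost (m : nat) (a : F) : int :=
  \sum_(al : {ffun 'I_m -> F} | [forall k, al k != 0])
     lam (\sum_(k < m) al k + a * (\prod_(k < m) al k)^-1).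

Definition MK (m h : nat) : int := \sum_(a : F | a != 0) Kloost m a ^+ h.

Definition theta (n : nat) (b : F) : int :=
  if b == 0 then 0 else Kloost (n - 2) b^-1.
End Defs.

Section Code.
Variables (F : finFieldType) (n : nat).

Definition SLset : {set 'M[F]_n} := [set g : 'M[F]_n | \det g == 1].

Definition nbeta (b : F) : nat := #|[set g in SLset | \tr g == b]|.

(* C_i: number of codewords of weight i in C(SL(n,q)); a binary word u is
   identified with its support A (a subset of SL(n,q)); u.v = sum_{g in A} Tr g. *)
Definition Cw (i : nat) : nat :=
  #|[set A : {set 'M[F]_n} |
       [&& A \subset SLset, #|A| == i & \sum_(g in A) \tr g == 0]]|.
End Code.

Definition stirling2 (h t : nat) : rat :=
  (t`!%:R)^-1 * \sum_(j < t.+1) (-1) ^+ (t - j) * 'C(t, j)%:R * (j%:R) ^+ h.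

(* Main.v *)
(** Averaging over left multiplication by unitriangular matrices shows that
    the sum of [lam (\tr g)] over the matrices [g] of determinant [d] is
    carried by the triangular ones; hence it equals [q ^ 'C(n, 2)] times a
    Kloosterman sum.  Scaling by [a] and the invariance of Kloosterman sums
    under squaring (here [n] is a power of 2) give
    [\sum_(g in SL) lam (a * \tr g) = q ^ 'C(n, 2) * Kloost r n.-1 a].
    Orthogonality of additive characters then yields the trace distribution.
    The same sum is [N] minus twice the weight of the dual word attached to
    [a], so the recursion is the Pless power moment identity: the h-th power
    of a weight is expanded in binomial coefficients, which count the t-subsets
    of its support, and orthogonality turns the sum over [a] into a count of
    codewords. *)

Require Import Defs.
From HB Require Import structures.
From mathcomp Require Import all_boot all_order all_algebra.
From mathcomp Require Import finfield zify ring.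
Set Implicit Arguments. Unset Strict Implicit. Unset Printing Implicit Defensive.
Import Order.TTheory GRing.Theory Num.Theory.
Local Open Scope ring_scope.

(** Reindexing by the translation equates the sum with its own negative. This is how every character
    sum below is shown to vanish. *)
Lemma sum_anti_translate (V : finZmodType) (P : pred V) (f : V -> int) (v0 : V) :
  (forall v, P (v + v0) = P v) -> (forall v, f (v + v0) = - f v) ->
  \sum_(v | P v) f v = 0.
Proof.
move=> hP hf.
suff : \sum_(v | P v) f v = - \sum_(v | P v) f v by lia.
rewrite {1}(reindex_inj (addIr v0)) /= -sumrN.
by apply: eq_big => v // _; rewrite hf.
Qed.

(** * The canonical additive character and Kloosterman sums over a field of even order *)

Section Character.
Variables (F : finFieldType) (r : nat).
Hypotheses (hr : (0 < r)%N) (hF : #|F| = (2 ^ r)%N).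
Local Notation lam := (@lam F r).
Local Notation q := (2 ^ r)%N.

Lemma pchar2F : 2 \in [pchar F].
Proof. exact: card_finPcharP hF _. Qed.

Lemma expf_pow2D (x y : F) k : (x + y) ^+ (2 ^ k) = x ^+ (2 ^ k) + y ^+ (2 ^ k).
Proof.
apply: exprDn_pchar; rewrite pnatX; apply/orP; left.
by rewrite pnatE ?pchar2F.
Qed.

Lemma abstrD (x y : F) : abstr r (x + y) = abstr r x + abstr r y.
Proof. by rewrite /abstr -big_split; apply: eq_bigr => k _; rewrite expf_pow2D. Qed.

(** Squaring permutes the conjugates [x ^+ (2 ^ k)] cyclically, the last one returning to [x]
    because [x ^+ q = x]. *)
Lemma abstr_sqr (x : F) : abstr r (x ^+ 2) = abstr r x.
Proof.
rewrite /abstr; under eq_bigr do rewrite -exprM -expnS.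
have -> : r = r.-1.+1 by rewrite prednK.
by rewrite big_ord_recr big_ord_recl /= prednK // -hF expf_card expr1 addrC.
Qed.

(** Squaring is additive in characteristic two, so it passes through the sum; this confines the
    trace to 0 and 1. *)
Lemma sqr_abstr (x : F) : abstr r x ^+ 2 = abstr r x.
Proof.
rewrite -[RHS]abstr_sqr /abstr.
have sq : {morph (fun y : F => y ^+ 2) : a b / a + b}.
  by move=> a b; rewrite -[2%N]/(2 ^ 1)%N expf_pow2D.
rewrite (big_morph _ sq (expr0n _ _)).
by apply: eq_bigr => k _; rewrite -!exprM mulnC.
Qed.

Lemma abstr_cases (x : F) : (abstr r x == 0) || (abstr r x == 1).
Proof.
have /eqP := sqr_abstr x; rewrite -subr_eq0 expr2 -{3}[abstr r x]mulr1 -mulrBr.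
by rewrite mulf_eq0 subr_eq0.
Qed.

Lemma lamD (x y : F) : lam (x + y) = lam x * lam y.
Proof.
rewrite /Defs.lam abstrD.
case/orP: (abstr_cases x) => /eqP->; case/orP: (abstr_cases y) => /eqP->;
  by rewrite ?addr0 ?add0r ?(addrr_pchar2 pchar2F) ?eqxx ?oner_eq0.
Qed.

Lemma lam0 : lam 0 = 1.
Proof.
rewrite /Defs.lam /abstr big1 ?eqxx // => k _.
by rewrite expr0n expn_eq0.
Qed.

Lemma lam_sqr (x : F) : lam (x ^+ 2) = lam x.
Proof. by rewrite /Defs.lam abstr_sqr. Qed.

Lemma lam_sum (I : finType) (P : pred I) (f : I -> F) :
  lam (\sum_(i | P i) f i) = \prod_(i | P i) lam (f i).
Proof. exact: (big_morph _ lamD lam0). Qed.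

(* The trace polynomial has degree 2^(r-1) < q, so it has a nonroot in F. *)
Lemma lam_nontrivial : exists x : F, lam x = -1.
Proof.
suff [x /negPf nz] : exists x : F, abstr r x != 0.
  by exists x; rewrite /Defs.lam nz.
apply/existsP; apply: contraT; rewrite negb_exists => /forallP h.
pose p : {poly F} := \sum_(k < r) 'X^(2 ^ k).
have sp : (size p <= (2 ^ r.-1).+1)%N.
  apply: leq_trans (size_sum _ _ _) _; apply/bigmax_leqP => k _.
  by rewrite size_polyXn ltnS leq_exp2l // -ltnS prednK.
(* Only [k = 0] contributes to the coefficient of degree 1, since [2 ^ k] is even for positive
   [k]. *)
have p0 : p != 0.
  apply/eqP => /(congr1 (fun p : {poly F} => p`_1)); rewrite coef0 coef_sum.
  have -> : r = r.-1.+1 by rewrite prednK.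
  rewrite big_ord_recl coefXn eqxx big1 ?addr0 => [/eqP|i _]; first by rewrite oner_eq0.
  by rewrite coefXn (_ : (1 == _)%N = false) // expnS; apply/negP; lia.
have := max_poly_roots p0 _ (enum_uniq F); rewrite -cardT hF.
case: allP => [_ /(_ isT)|[]].
  move=> /leq_trans/(_ sp); rewrite -[X in (2 ^ X < _)%N](prednK hr) expnS.
  have := expn_gt0 2 r.-1; lia.
move=> x _; rewrite rootE horner_sum; have /negPn := h x.
by rewrite /abstr; under eq_bigr do rewrite -hornerXn.
Qed.

Lemma lam_orthogonal (a : F) : \sum_(x : F) lam (a * x) = if a == 0 then q%:Z else 0.
Proof.
case: eqP => [->|/eqP a0].
  under eq_bigr do rewrite mul0r lam0.
  by rewrite sumr_const -hF natz.
have [y hy] := lam_nontrivial.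
(* Translating by [a^-1 * y] adds [y] to the argument, hence multiplies each term by
   [lam y = -1]. *)
apply: (@sum_anti_translate F xpredT _ (a^-1 * y)) => // x.
by rewrite mulrDr mulVKf // lamD hy mulrN1.
Qed.

Lemma sum_lam_unit : \sum_(x : F | x != 0) lam x = -1.
Proof.
have := lam_orthogonal 1; rewrite oner_eq0 (bigD1 0) //= mulr0 lam0.
move/eqP; rewrite addrC addr_eq0 => /eqP <-.
by apply: eq_bigr => x _; rewrite mul1r.
Qed.

(** Symmetric form of the Kloosterman sum: the coordinates are tied by their product, as the
    diagonal entries of a triangular matrix are by its determinant. *)
Definition prod_Kloost m (d : F) : int :=
  \sum_(al : {ffun 'I_m -> F} | \prod_k al k == d) lam (\sum_k al k).

(** As [d] is nonzero, all coordinates are units, and the first one is recovered as [d] divided by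
    the product of the others. *)
Lemma prod_KloostS m (d : F) : d != 0 -> prod_Kloost m.+1 d = Kloost r m d.
Proof.
move=> d0; rewrite /prod_Kloost /Kloost.
pose ext (al : {ffun 'I_m -> F}) : {ffun 'I_m.+1 -> F} :=
  [ffun i => if unlift ord0 i is Some j then al j else d * (\prod_k al k)^-1].
pose res (al : {ffun 'I_m.+1 -> F}) : {ffun 'I_m -> F} := [ffun j => al (lift ord0 j)].
have ext0 al : ext al ord0 = d * (\prod_k al k)^-1 by rewrite ffunE unlift_none.
have extS al j : ext al (lift ord0 j) = al j by rewrite ffunE liftK.
have resE al : \prod_k res al k = \prod_k al (lift ord0 k).
  by apply: eq_bigr => j _; rewrite ffunE.
rewrite (reindex_onto ext res) => [|al /eqP al1]; last first.
  have nz : \prod_k al (lift ord0 k) != 0.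
    by apply: contraNneq d0 => z; rewrite -al1 big_ord_recl z mulr0.
  apply/ffunP => i; case: (unliftP ord0 i) => [j ->|->].
    by rewrite extS ffunE.
  by rewrite ext0 resE -al1 big_ord_recl mulfK.
apply: eq_big => [al|al _].
  have -> : res (ext al) = al by apply/ffunP=> j; rewrite ffunE extS.
  rewrite eqxx andbT big_ord_recl ext0 (eq_bigr _ (fun j _ => extS al j));
    apply/eqP/forallP => [h k|h].
    apply: contraNneq d0 => z.
    by rewrite -h (bigD1 k (F := fun i => al i)) //= z mul0r mulr0.
  by rewrite divfK //; apply/prodf_neq0 => k _; apply: h.
by rewrite big_ord_recl ext0 addrC (eq_bigr _ (fun j _ => extS al j)).
Qed.

(** Squaring every coordinate permutes the index set and squares the argument of [lam], which leaves
    its value unchanged. *)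
Lemma Kloost_sqr m (a : F) : Kloost r m (a ^+ 2) = Kloost r m a.
Proof.
rewrite /Kloost.
have inj2 : injective (fun x : F => x ^+ 2).
  move=> x y /eqP; rewrite -subr_eq0 subr_sqr mulf_eq0 subr_eq0 => /orP[/eqP//|].
  by rewrite addr_eq0 (oppr_pchar2 pchar2F) => /eqP.
pose sq (al : {ffun 'I_m -> F}) : {ffun 'I_m -> F} := [ffun k => al k ^+ 2].
have injsq : injective sq.
  by move=> a1 a2 /ffunP h; apply/ffunP => k; apply: inj2; have := h k; rewrite !ffunE.
rewrite (reindex_inj injsq); apply: eq_big => [al|al _].
  by apply: eq_forallb => k; rewrite ffunE expf_eq0.
rewrite -[RHS]lam_sqr; congr lam.
have sqD : {morph (fun y : F => y ^+ 2) : x y / x + y}.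
  by move=> x y; rewrite -[2%N]/(2 ^ 1)%N expf_pow2D.
rewrite sqD exprMn exprVn -prodrXl (big_morph _ sqD (expr0n _ _)).
congr (_ + _ * _^-1); first by apply: eq_bigr => k _; rewrite ffunE.
by apply: eq_bigr => k _; rewrite ffunE.
Qed.

Lemma Kloost_pow2 m s (a : F) : Kloost r m (a ^+ (2 ^ s)) = Kloost r m a.
Proof. by elim: s => [|s IH]; rewrite ?expr1 // expnSr exprM Kloost_sqr. Qed.

Lemma sum_lam_units m :
  \sum_(al : {ffun 'I_m -> F} | [forall k, al k != 0]) lam (\sum_k al k) = (-1) ^+ m.
Proof.
under eq_bigr do rewrite lam_sum.
rewrite -[m in RHS]card_ord -prodr_const -sum_lam_unit bigA_distr_big.
by apply: eq_bigl => al; apply/forallP/ffun_onP.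
Qed.

(** For fixed coordinates, orthogonality in [a] forces their product to be [b^-1], which lowers the
    dimension by one. The missing term [a = 0] accounts for the subtracted sum over all unit
    tuples. *)
Lemma sum_lam_Kloost m (b : F) :
  \sum_(a : F | a != 0) lam (a * b) * Kloost r m.+1 a =
  q%:Z * (if b == 0 then 0 else Kloost r m b^-1) - (-1) ^+ m.+1.
Proof.
transitivity (\sum_(al : {ffun 'I_m.+1 -> F} | [forall k, al k != 0])
   lam (\sum_k al k) * ((if \prod_k al k == b^-1 then q%:Z else 0) - 1)).
  rewrite /Kloost; under eq_bigr do rewrite mulr_sumr.
  rewrite exchange_big /=; apply: eq_bigr => al /forallP hal.
  have nz : \prod_k al k != 0 by apply/prodf_neq0 => k _; apply: hal.
  under eq_bigr do rewrite lamD mulrCA -lamD -mulrDr.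
  rewrite -mulr_sumr; congr (_ * _).
  have := lam_orthogonal (b + (\prod_k al k)^-1).
  rewrite (bigD1 0) //= mulr0 lam0; under eq_bigr do rewrite mulrC.
  rewrite addr_eq0 (oppr_pchar2 pchar2F) -(inj_eq invr_inj) invrK eq_sym => <-.
  by rewrite [1 + _]addrC addrK.
under eq_bigr do rewrite mulrBr mulr1.
rewrite sumrB sum_lam_units; congr (_ - _).
(* With the convention [0^-1 = 0], the case [b = 0] asks for a product of units equal to 0, so
   nothing survives. *)
have [->|b0] := eqVneq b 0.
  rewrite mulr0 big1 // => al /forallP hal; rewrite invr0.
  have /negPf -> : \prod_k al k != 0 by apply/prodf_neq0 => k _; apply: hal.
  by rewrite mulr0.
rewrite -prod_KloostS ?invr_eq0 // /prod_Kloost mulr_sumr big_mkcond [RHS]big_mkcond /=.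
apply: eq_bigr => al _; case: eqP => [e|_]; last by case: ifP; rewrite ?mulr0.
rewrite mulrC ifT //; apply/forallP => k; apply: contraNneq b0 => z.
by rewrite -invr_eq0 -e (bigD1 k) //= z mul0r.
Qed.

End Character.

(** * Triangular matrices and the order of the special linear group *)

Section TriangularMatrices.
Variable R : finComNzRingType.

(** Strictly lower triangular, to agree with [is_trig_mx]; the matrices [1%:M + m] are then the
    lower unitriangular ones. *)
Definition strict_trig n (m : 'M[R]_n) := [forall i : 'I_n, forall j : 'I_n, (i <= j)%N ==> (m i j == 0)].

Lemma strict_trigP n (m : 'M[R]_n) :
  reflect (forall i j : 'I_n, (i <= j)%N -> m i j = 0) (strict_trig m).
Proof.
apply: (iffP forallP) => [h i j ij|h i].
  by have /forallP/(_ j)/implyP/(_ ij)/eqP := h i.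
by apply/forallP => j; apply/implyP => /h/eqP.
Qed.

Lemma strict_trigDr n (m m0 : 'M[R]_n) :
  strict_trig m0 -> strict_trig (m + m0) = strict_trig m.
Proof.
move=> /strict_trigP h0; apply/strict_trigP/strict_trigP => h i j ij; have := h i j ij;
  by rewrite mxE (h0 _ _ ij) addr0.
Qed.

(** Entries are chosen independently, and row [i] has [i] free ones; these numbers add up to
    ['C(n, 2)]. *)
Lemma card_strict_trig n : #|[set m : 'M[R]_n | strict_trig m]| = (#|R| ^ 'C(n, 2))%N.
Proof.
pose Q (p : 'I_n * 'I_n) : pred R := fun x => (p.1 <= p.2)%N ==> (x == 0).
pose mk (f : {ffun 'I_n * 'I_n -> R}) : 'M[R]_n := \matrix_(i, j) f (i, j).
have injmk : injective mk.
  move=> f g /matrixP h; apply/ffunP => -[i j]; by have := h i j; rewrite !mxE.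
have -> : [set m : 'M[R]_n | strict_trig m] = mk @: [set f | f \in family Q].
  apply/setP => m; rewrite inE; apply/strict_trigP/imsetP => [h|[f]].
    exists [ffun p => m p.1 p.2]; last by apply/matrixP => i j; rewrite !mxE ffunE.
    rewrite inE; apply/familyP => -[i j]; rewrite ffunE unfold_in /=.
    by apply/implyP => /h ->.
  rewrite inE => /familyP h -> i j ij; rewrite mxE.
  by have := h (i, j); rewrite unfold_in /= ij => /eqP.
rewrite card_imset // cardsE -sum1_card.
transitivity (\sum_(f in family Q) \prod_(p : 'I_n * 'I_n) 1)%N.
  by apply: eq_bigr => f _; rewrite big1.
rewrite -(bigA_distr_big_dep Q (fun _ _ => 1%N)).
rewrite -(pair_bigA _ (fun i j => \sum_(x | Q (i, j) x) 1)%N) /= -bin2_sum big_mkord expn_sum.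
apply: eq_bigr => i _.
rewrite (eq_bigr (fun j : 'I_n => if (j < i)%N then #|R| else 1%N)) => [|j _]; last first.
  rewrite sum1_card /Q /=; case: ltnP => [_|_]; first by apply: eq_card.
  by rewrite /= (eq_card (B := pred1 0)) ?card1 // => x; rewrite inE.
by rewrite -big_mkcond /= -(big_ord_widen n (fun _ =>
  #|R|) (ltnW (ltn_ord i))) prod_nat_const card_ord.
Qed.

(** The set is the translate of the strictly triangular matrices by the diagonal matrix [D]. *)
Lemma card_trig_diag n (al : {ffun 'I_n -> R}) :
  #|[set g : 'M[R]_n | is_trig_mx g & [ffun i => g i i] == al]| = (#|R| ^ 'C(n, 2))%N.
Proof.
rewrite -card_strict_trig.
pose D : 'M[R]_n := diag_mx (\row_i al i).
rewrite -[RHS](card_imset _ (addrI D)); congr #|pred_of_set _|; apply/setP => g.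
rewrite inE; apply/andP/imsetP => [[/is_trig_mxP gt /eqP ga]|[m]].
  exists (g - D); last by rewrite addrC subrK.
  rewrite inE; apply/strict_trigP => i j; rewrite leq_eqVlt => /orP[/eqP/ord_inj <-|ij].
    by rewrite !mxE eqxx -ga ffunE mulr1n subrr.
  by rewrite !mxE gt // (_ : (i == j) = false) ?mulr0n ?subrr //; apply/negP => /eqP e;
    rewrite e ltnn in ij.
rewrite inE => /strict_trigP h ->; split.
  apply/is_trig_mxP => i j ij; rewrite !mxE (h i j (ltnW ij)) (_ : (i == j) = false)
    ?mulr0n ?addr0 //.
  by apply/negP => /eqP e; rewrite e ltnn in ij.
by apply/eqP/ffunP => i; rewrite ffunE !mxE eqxx (h i i (leqnn i)) addr0 mulr1n.
Qed.

End TriangularMatrices.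

(** The determinant splits GL into [#|F| - 1] classes, each the image of SL under left
    multiplication by [diag(d, 1, ..., 1)]. The number of classes cancels the factor [j = 1] in the
    order of GL. *)
Lemma card_SLset (F : finFieldType) n : (0 < n)%N ->
  #|SLset F n| = (#|F| ^ 'C(n, 2) * \prod_(2 <= j < n.+1) (#|F| ^ j - 1))%N.
Proof.
case: n => // n _.
have q1 : (0 < #|F| - 1)%N by rewrite subn_gt0 finNzRing_gt1.
apply/eqP; rewrite -(eqn_pmul2l q1) mulnCA; apply/eqP.
have -> : ((#|F| - 1) * \prod_(2 <= j < n.+2) (#|F| ^ j - 1) =
          \prod_(1 <= j < n.+2) (#|F| ^ j - 1))%N by rewrite [RHS]big_ltn.
rewrite -card_GL //.
rewrite cardsT card_sub -[RHS]sum1_card.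
rewrite [RHS](partition_big (fun g : 'M[F]_n.+1 => \det g) (fun d => d != 0)) /=; last first.
  by move=> g; rewrite -unitfE.
transitivity (\sum_(d : F | d != 0%R) #|SLset F n.+1|)%N.
  by rewrite sum_nat_const (cardC1 (0 : F)) subn1.
apply: eq_bigr => d d0.
pose D : 'M[F]_n.+1 := diag_mx (\row_i (if i == 0 then d else 1)).
have detD : \det D = d.
  rewrite det_diag big_ord_recl !mxE eqxx big1 ?mulr1 // => i _.
  by rewrite !mxE.
have UD : D \in unitmx by rewrite unitmxE detD unitfE.
rewrite sum1_card -(card_imset _ (can_inj (mulKmx UD))).
rewrite cardE [RHS]cardE; congr size; apply: eq_enum => g.
rewrite [RHS]unfold_in; apply/imsetP/andP => [[h]|[_ /eqP hd]].
  by rewrite inE => /eqP h1 ->; rewrite inE -[_ \in _]/(_ \in unitmx)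
    unitmxE det_mulmx h1 detD mulr1 unitfE d0 eqxx.
exists (invmx D *m g); last by rewrite mulKVmx.
by rewrite inE det_mulmx det_inv detD hd mulVf.
Qed.

(** * Character sums of the trace over matrices of fixed determinant *)

Section TraceSums.
Variables (F : finFieldType) (r : nat).
Hypotheses (hr : (0 < r)%N) (hF : #|F| = (2 ^ r)%N).
Local Notation lam := (@lam F r).
Local Notation q := (2 ^ r)%N.

(** For triangular [g] the product [m *m g] has zero diagonal, so every term is 1. Otherwise a
    nonzero entry of [g] above the diagonal makes the character nontrivial on the strictly
    triangular matrices. *)
Lemma sum_strict_trig_lam n (g : 'M[F]_n) :
  \sum_(m : 'M[F]_n | strict_trig m) lam (\tr (m *m g)) =
  if is_trig_mx g then (q ^ 'C(n, 2))%:Z else 0.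
Proof.
case: ifP => [/is_trig_mxP gt|].
  rewrite (eq_bigr (fun _ => 1)) => [|m /strict_trigP hm].
    by rewrite sumr_const -cardsE card_strict_trig hF natz.
  suff -> : \tr (m *m g) = 0 by rewrite lam0.
  rewrite /mxtrace big1 // => i _; rewrite mxE big1 // => j _.
  by have [ij|ji] := leqP i j; rewrite ?(hm i j ij) ?(gt j i ji) ?mul0r ?mulr0.
move/negP=> gnt.
have [i [j [ij gij]]] : exists i : 'I_n, exists j : 'I_n, (i < j)%N /\ g i j != 0.
  have : [exists i : 'I_n, exists j : 'I_n, (i < j)%N && (g i j != 0)].
    apply: contraT => h; case: gnt; apply/is_trig_mxP => i j ij.
    move: h; rewrite negb_exists => /forallP/(_ i); rewrite negb_exists => /forallP/(_ j).
    by rewrite ij /= negbK => /eqP.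
  by move=> /existsP[i /existsP[j /andP[]]]; exists i, j.
have [y hy] := lam_nontrivial hr hF.
(* The scalar is chosen so that [\tr (m0 *m g) = y]. *)
pose m0 : 'M[F]_n := (y / g i j) *: delta_mx j i.
have m0t : strict_trig m0.
  apply/strict_trigP => k l kl; rewrite !mxE; case: (eqVneq k j) => [ek|_];
    last by rewrite mulr0.
  case: (eqVneq l i) => [el|_]; last by rewrite mulr0.
  by move: kl; rewrite ek el leqNgt ij.
apply: (@sum_anti_translate _ _ _ m0) => m; first exact: strict_trigDr.
rewrite mulmxDl raddfD /= lamD // -scalemxAl mxtraceZ.
have -> : \tr (delta_mx j i *m g) = g i j.
  rewrite /mxtrace (bigD1 j) //= big1 ?addr0 => [|k /negPf kj].
    rewrite mxE (bigD1 i) //= big1 ?addr0 => [|k /negPf ki].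
      by rewrite mxE !eqxx mul1r.
    by rewrite mxE ki andbF mul0r.
  by rewrite mxE big1 // => l _; rewrite mxE kj mul0r.
by rewrite divfK // hy mulrN1.
Qed.

Lemma sum_det_lam_tr n (d : F) :
  \sum_(g : 'M[F]_n | \det g == d) lam (\tr g) =
  (q ^ 'C(n, 2))%:Z * prod_Kloost r n d.
Proof.
set V := (q ^ 'C(n, 2))%:Z; set S := LHS.
have V0 : V != 0 by rewrite /V; lia.
have -> : S = \sum_(g : 'M[F]_n | (\det g == d) && is_trig_mx g) lam (\tr g).
  apply: (mulfI V0).
  (* One copy of [S] is taken for each unitriangular [1%:M + m]; left multiplication by it preserves
     the determinant. *)
  have {1}-> : V = \sum_(m : 'M[F]_n | strict_trig m) 1.
    by rewrite sumr_const -cardsE card_strict_trig hF natz.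
  transitivity (\sum_(m : 'M[F]_n | strict_trig m)
      \sum_(g : 'M[F]_n | \det g == d) lam (\tr ((1%:M + m) *m g))).
    rewrite mulr_suml; apply: eq_bigr => m /strict_trigP hm; rewrite mul1r.
    have det1m : \det (1%:M + m) = 1.
      rewrite det_trig; first by rewrite big1 // => i _; rewrite !mxE eqxx hm // addr0.
      apply/is_trig_mxP => i j ij; rewrite !mxE hm ?(ltnW ij) // addr0.
      by rewrite (_ : (i == j) = false) //; apply/negP => /eqP e; rewrite e ltnn in ij.
    have U : 1%:M + m \in unitmx by rewrite unitmxE det1m unitr1.
    rewrite /S (reindex_inj (can_inj (mulKmx U))) /=.
    by apply: eq_bigl => g; rewrite det_mulmx det1m mul1r.
  rewrite exchange_big /= big_mkcondr /= mulr_sumr; apply: eq_bigr => g _.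
  under eq_bigr do rewrite mulmxDl mul1mx raddfD /= lamD //.
  rewrite -mulr_sumr sum_strict_trig_lam mulrC.
  by case: ifP; rewrite ?mulr0 ?mul0r.
(* Both the trace and the determinant of a triangular matrix depend only on its diagonal, and each
   diagonal occurs [V] times. *)
rewrite (partition_big (fun g : 'M[F]_n => [ffun i => g i i])
   (fun al : {ffun 'I_n -> F} => \prod_k al k == d)) /=; last first.
  move=> g /andP[/eqP <- gt]; rewrite det_trig //; apply/eqP; apply: eq_bigr => i _.
  by rewrite ffunE.
rewrite /prod_Kloost mulr_sumr; apply: eq_bigr => al /eqP hal.
rewrite (eq_bigr (fun _ => lam (\sum_k al k))) => [|g /andP[_ /eqP <-]]; last first.
  by congr lam; apply: eq_bigr => i _; rewrite ffunE.
rewrite sumr_const -mulr_natl; congr (_ * _).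
rewrite /V -hF -(card_trig_diag al) natz -[in LHS]cardsE; congr Posz.
apply: eq_card => g; rewrite !inE unfold_in -andbA.
case gt: (is_trig_mx g); last by rewrite andbF.
case: (_ =P al) => [ga|_]; last by rewrite !andbF.
rewrite !andbT -hal -ga det_trig //; apply/eqP; apply: eq_bigr => i _.
by rewrite ffunE.
Qed.

Section Power2.
Variables (n s : nat).
Hypotheses (hn : n = (2 ^ s)%N) (n1 : (1 < n)%N).

Lemma SL_lam_tr (a : F) : a != 0 ->
  \sum_(g in SLset F n) lam (a * \tr g) = (q ^ 'C(n, 2))%:Z * Kloost r n.-1 a.
Proof.
move=> a0; rewrite -(Kloost_pow2 hr hF n.-1 s a) -hn -prod_KloostS ?expf_neq0 //.
rewrite prednK ?(ltnW n1) // -sum_det_lam_tr.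
(* Scaling by [a] carries determinant 1 to [a ^+ n]. *)
rewrite [RHS](reindex_inj (can_inj (scalerK a0))) /=.
apply: eq_big => [g|g _]; last by rewrite mxtraceZ.
by rewrite inE detZ -{2}[a ^+ n]mulr1 (inj_eq (mulfI (expf_neq0 _ a0))).
Qed.

Lemma nbeta_Kloost (b : F) :
  (nbeta n b)%:Z = (q ^ ('C(n, 2) - 1))%:Z *
    ((\prod_(2 <= j < n.+1) (q ^ j - 1))%N%:Z + 1 + q%:Z * theta r n b).
Proof.
set P := (\prod_(_ <= j < _) _)%N.
have q0 : q%:Z != 0 by lia.
(* Orthogonality naturally counts [q] times [nbeta n b], so the identity is multiplied by [q]. *)
apply: (mulfI q0); rewrite [RHS]mulrA -[in RHS]PoszM -expnS subn1 prednK ?bin_gt0 //.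
transitivity (\sum_(g in SLset F n) \sum_(a : F) lam ((\tr g - b) * a)).
  rewrite (eq_bigr _ (fun g _ => lam_orthogonal hr hF (\tr g - b))) -big_mkcondr /=.
  rewrite sumr_const -mulr_natr natz /nbeta; congr (_ * Posz _).
  by apply: eq_card => g; rewrite inE [RHS]unfold_in subr_eq0.
(* The term [a = 0] contributes the order of SL. *)
rewrite exchange_big /= (bigD1 0) //= (eq_bigr (fun _ => 1)) => [|g _]; last first.
  by rewrite mulr0 lam0.
rewrite sumr_const card_SLset ?(ltnW n1) // hF -/P natz PoszM -addrA mulrDr; congr (_ + _).
transitivity (\sum_(a : F | a != 0) lam (a * b) * ((q ^ 'C(n, 2))%:Z * Kloost r n.-1 a)).
  apply: eq_bigr => a a0; rewrite -SL_lam_tr // mulr_sumr; apply: eq_bigr => g _.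
  by rewrite (oppr_pchar2 (pchar2F hF)) mulrC mulrDr addrC lamD.
under eq_bigr do rewrite mulrCA.
rewrite -mulr_sumr; congr (_ * _).
have -> : n.-1 = n.-2.+1 by rewrite prednK // -subn1 subn_gt0.
rewrite sum_lam_Kloost // addrC /theta subn2; congr (_ + _).
(* As [n] is even, [n.-1] is odd; the sign [- (-1) ^+ n.-1] becomes the summand [+ 1]. *)
have -> : n.-2.+1 = (2 ^ s.-1).-1.*2.+1.
  move: n1; rewrite hn; case: (s) => // k _.
  by rewrite expnS /=; have := expn_gt0 2 k; lia.
by rewrite -signr_odd /= odd_double expr1 opprK.
Qed.

End Power2.
End TraceSums.

(** * Subset counts and the weight distribution of the code *)

Section Combinatorics.
Variables (X J : finType).
Implicit Types (S A B : {set X}) (f : X -> J).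

(** A subset of [S] amounts to an independent choice of a subset in each fiber of [f]. *)
Lemma card_sets_with_fiber_cards S f (nu : J -> nat) :
  #|[set A : {set X} | A \subset S & [forall b, #|[set x in A | f x == b]| == nu b]]|
  = (\prod_b 'C(#|[set x in S | f x == b]|, nu b))%N.
Proof.
pose fib A b := [set x in A | f x == b].
pose Q b : pred {set X} := fun B => (B \subset fib S b) && (#|B| == nu b).
pose sp A : {ffun J -> {set X}} := [ffun b => fib A b].
have sp_inj : injective sp.
  move=> A B /ffunP h; apply/setP => x.
  by have /setP/(_ x) := h (f x); rewrite !ffunE !inE eqxx !andbT.
rewrite -(card_imset _ sp_inj).
transitivity (\sum_(B in family Q) \prod_(b : J) 1)%N.
  rewrite (eq_bigr (fun _ => 1%N)) => [|B _]; last by rewrite big1.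
  rewrite sum1_card; apply: eq_card => B; apply/imsetP/familyP => [[A]|h].
    rewrite inE => /andP[AS /forallP hA] -> b; rewrite unfold_in /Q ffunE hA andbT.
    by apply/subsetP => x; rewrite !inE => /andP[/(subsetP AS) -> ->].
  have hB b x : x \in B b -> x \in S /\ f x = b.
    by have := h b; rewrite unfold_in => /andP[/subsetP hs _] /hs;
      rewrite inE => /andP[-> /eqP].
  have eqB : B = sp (\bigcup_b B b).
    apply/ffunP => b; rewrite ffunE; apply/setP => x; rewrite inE.
    apply/idP/andP => [xb|[/bigcupP[c _ xc] /eqP fx]].
      by split; [apply/bigcupP; exists b | apply/eqP; case: (hB _ _ xb)].
    by case: (hB _ _ xc) => _; rewrite fx => ->.
  exists (\bigcup_b B b) => //; rewrite inE; apply/andP; split.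
    by apply/bigcupsP => b _; apply/subsetP => x /hB[].
  apply/forallP => b; have := h b; rewrite unfold_in => /andP[_].
  by rewrite {1}eqB ffunE.
rewrite -(bigA_distr_big_dep Q (fun _ _ => 1%N)); apply: eq_bigr => b _.
by rewrite sum1_card -cards_draws cardsE; apply: eq_card => B.
Qed.

Lemma card_between A S t : A \subset S ->
  #|[set B : {set X} | [&& A \subset B, B \subset S & #|B| == t]]|
  = (if (#|A| <= t)%N then 'C(#|S| - #|A|, t - #|A|) else 0)%N.
Proof.
move=> AS; case: leqP => At; last first.
  apply/eqP; rewrite cards_eq0; apply/eqP/setP => B; rewrite !inE.
  by apply/negP => /and3P[/subset_leq_card AB _ /eqP Bt]; rewrite Bt leqNgt At in AB.
have -> : (#|S| - #|A| = #|S :\: A|)%N by rewrite cardsD (setIidPr AS).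
rewrite -cards_draws -[RHS](card_in_imset (f := fun C => A :|: C)).
  apply: eq_card => B; rewrite inE; apply/and3P/imsetP => [[AB BS /eqP Bt]|[C]].
    exists (B :\: A); last by rewrite setDE setUIr setUCr setIT (setUidPr AB).
    by rewrite inE setSD //= cardsD (setIidPr AB) Bt.
  rewrite inE => /andP[]; rewrite subsetD => /andP[CS CA] /eqP Ct ->; split.
  - exact: subsetUl.
  - by rewrite subUset AS.
  - rewrite cardsU Ct; move: CA; rewrite disjoint_sym -setI_eq0 => /eqP->.
    by rewrite cards0 subn0 subnKC.
move=> B C; rewrite !inE !subsetD => /andP[/andP[_ BA] _] /andP[/andP[_ CA] _] e.
have key (D : {set X}) : [disjoint D & A] -> (A :|: D) :\: A = D.
  by move=> DA; rewrite setDUl setDv set0U; apply/setDidPl.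
by rewrite -(key B) // e key.
Qed.

Lemma prod_in_addr1 (R : comNzRingType) (x : X -> R) B :
  \prod_(i in B) (1 + x i) = \sum_(A : {set X} | A \subset B) \prod_(i in A) x i.
Proof.
(* Outside [B] the factor 1 is written [0 + 1], so that expanding over all of [X] kills every set
   not contained in [B]. *)
rewrite big_mkcond /= (eq_bigr (fun i => (if i \in B then x i else 0) + 1)) => [|i _];
  last first.
  by case: ifP; rewrite ?add0r // addrC.
rewrite bigA_distr [RHS]big_mkcond /=; apply: eq_bigr => A _.
case: ifP => [/subsetP AB|/negbT/subsetPn[i iA /negPf iB]].
  by rewrite [RHS]big_mkcond; apply: eq_bigr => i _; case: ifP => // /AB ->.
by rewrite (bigD1 i) //= iA iB mul0r.
Qed.

End Combinatorics.

(** Weight and orthogonality depend only on how many elements of each trace a word contains, so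
    codewords are grouped by this profile. *)
Lemma Cw_fiberwise (F : finFieldType) n i :
  Cw F n i = (\sum_(nu : {ffun F -> 'I_i.+1} |
                   ((\sum_(b : F) (nu b : nat))%N == i)
                   && ((\sum_(b : F) (b *+ nu b))%R == 0%R))
             \prod_(b : F) 'C(nbeta n b, nu b))%N.
Proof.
pose fib (A : {set 'M[F]_n}) (b : F) := [set g in A | \tr g == b].
have card_fib A : (\sum_b #|fib A b| = #|A|)%N.
  rewrite -sum1_card (partition_big (fun g => \tr g) xpredT) //=.
  by apply: eq_bigr => b _; rewrite -sum1_card; apply: eq_bigl => g; rewrite inE.
have sum_fib A : \sum_b b *+ #|fib A b| = \sum_(g in A) \tr g.
  rewrite [RHS](partition_big (fun g => \tr g) xpredT) //=.
  apply: eq_bigr => b _; rewrite (eq_bigr (fun _ => b)) => [|g /andP[_ /eqP]//].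
  by rewrite sumr_const /fib -cardsE; congr (_ *+ _); apply: eq_card => g; rewrite !inE.
(* [inord] loses nothing here: a fiber of a set of size [i] has at most [i] elements. *)
pose prof A : {ffun F -> 'I_i.+1} := [ffun b => inord #|fib A b|].
have profE (A : {set 'M[F]_n}) : #|A| = i -> forall b, prof A b = #|fib A b| :> nat.
  move=> Ai b; rewrite ffunE inordK // ltnS -Ai; apply: subset_leq_card.
  by apply/subsetP => g; rewrite inE => /andP[].
rewrite /Cw -sum1_card (partition_big prof (fun nu : {ffun F -> 'I_i.+1} =>
  ((\sum_(b : F) (nu b : nat))%N == i) && ((\sum_(b : F) (b *+ nu b))%R == 0%R))) /=;
    last first.
  move=> A; rewrite inE => /and3P[_ /eqP Ai /eqP A0].
  under eq_bigr do rewrite profE //.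
  rewrite card_fib Ai eqxx /=.
  by under eq_bigr do rewrite profE //; rewrite sum_fib A0.
apply: eq_bigr => nu /andP[/eqP nui /eqP nu0].
rewrite -(card_sets_with_fiber_cards (SLset F n) (fun g => \tr g) (fun b => nu b)) sum1_card.
rewrite -cardsE; apply: eq_card => A; rewrite inE unfold_in !inE -!andbA; congr (_ && _).
apply/and3P/forallP => [[/eqP Ai _ /eqP <-] b|h]; first by rewrite profE.
have Ai : #|A| = i by rewrite -card_fib -[RHS]nui; apply: eq_bigr => b _; apply/eqP/h.
split; first by apply/eqP.
  by rewrite -sum_fib -[in X in _ == X]nu0; apply/eqP; apply: eq_bigr => b _;
    congr (_ *+ _); apply/eqP/h.
by apply/eqP/ffunP => b; apply/val_inj; rewrite /= profE //; apply/eqP/h.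
Qed.

(** * Surjection numbers and the expansion of powers in binomial coefficients *)

(* The number t! S(h, t) of surjections from an h-set onto a t-set. *)
Definition surj2 (h t : nat) : rat :=
  \sum_(j < t.+1) (-1) ^+ (t - j) * 'C(t, j)%:R * j%:R ^+ h.

Lemma fact_stirling2 h t : t`!%:R * stirling2 h t = surj2 h t.
Proof. by rewrite /stirling2 mulVKf // pnatr_eq0 -lt0n fact_gt0. Qed.

Lemma surj2_0 t : surj2 0 t = (t == 0%N)%:R.
Proof.
have := exprDn (1 : rat) (-1) t; rewrite subrr expr0n => ->.
rewrite /surj2 (reindex_inj rev_ord_inj) /=; apply: eq_bigr => j _.
have jt : (j <= t)%N by rewrite -ltnS.
by rewrite subSS subKn // bin_sub // expr1n mulr1 mul1r mulr_natr.
Qed.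

Lemma surj2S0 h : surj2 h.+1 0 = 0.
Proof. by rewrite /surj2 big_ord1 expr0n mulr0. Qed.

(** Surjection recurrence: once the image of the extra element is chosen, the other [h] elements
    cover either everything or all but that value. The formal proof uses Pascal's rule and
    absorption. *)
Lemma surj2S h t : surj2 h.+1 t.+1 = t.+1%:R * (surj2 h t.+1 + surj2 h t).
Proof.
(* The added term carries ['C(t, t.+1) = 0], so both sums get the same range. *)
have widen : surj2 h t = - \sum_(j < t.+2) (-1) ^+ (t.+1 - j) * 'C(t, j)%:R * j%:R ^+ h.
  rewrite big_ord_recr /= bin_small // mulr0 mul0r addr0 -sumrN; apply: eq_bigr => j _.
  by rewrite subSn -1?ltnS // exprS mulN1r !mulNr opprK.
rewrite widen /surj2 -sumrB mulr_sumr big_ord_recl [RHS]big_ord_recl /=.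
rewrite expr0n mulr0 !bin0 subrr mulr0; congr (_ + _).
apply: eq_bigr => j _; rewrite /bump leq0n add1n.
have e : (j.+1%:R * 'C(t.+1, j.+1)%:R = t.+1%:R * 'C(t, j)%:R :> rat).
  by rewrite -!natrM -mul_bin_diag.
have -> : 'C(t, j.+1)%:R = 'C(t.+1, j.+1)%:R - 'C(t, j)%:R :> rat.
  by rewrite binS natrD addrK.
rewrite exprS -mulrA [_ * (j.+1%:R * _)]mulrA [_ * j.+1%:R]mulrC e; ring.
Qed.

Lemma surj2_gt h t : (h < t)%N -> surj2 h t = 0.
Proof.
elim: h t => [|h IH] [|t] // ht; first by rewrite surj2_0.
by rewrite surj2S !IH ?addr0 ?mulr0 // ltnW.
Qed.

(** Maps from an [h]-set to a [w]-set are sorted by the size [t] of their image; the induction on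
    [h] uses the surjection recurrence. *)
Lemma expr_surj2 w h : w%:R ^+ h = \sum_(t < h.+1) surj2 h t * 'C(w, t)%:R :> rat.
Proof.
elim: h => [|h IH]; first by rewrite big_ord1 surj2_0 bin0 mulr1.
rewrite exprS IH mulr_sumr [RHS]big_ord_recl surj2S0 mul0r add0r /=.
have step t : w%:R * 'C(w, t)%:R = t%:R * 'C(w, t)%:R + t.+1%:R * 'C(w, t.+1)%:R :> rat.
  rewrite -!natrM -natrD; congr _%:R.
  have [tw|wt] := leqP t w; last by rewrite !bin_small ?muln0 // ltnW.
  by rewrite mul_bin_left -mulnDl subnKC.
(* The end terms vanish: the factor [t] is 0 at the bottom, and [surj2 h h.+1 = 0] at the top. *)
have shift : \sum_(t < h.+1) surj2 h t * (t%:R * 'C(w, t)%:R)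
    = \sum_(t < h.+1) surj2 h t.+1 * (t.+1%:R * 'C(w, t.+1)%:R).
  by rewrite big_ord_recl [RHS]big_ord_recr /= (surj2_gt (ltnSn h)) !mul0r !mulr0 addr0 add0r.
transitivity (\sum_(t < h.+1) surj2 h t * (t%:R * 'C(w, t)%:R)
   + \sum_(t < h.+1) surj2 h t * (t.+1%:R * 'C(w, t.+1)%:R)).
  by rewrite -big_split; apply: eq_bigr => t _; rewrite mulrCA step mulrDr.
rewrite shift -big_split; apply: eq_bigr => t _ /=.
by rewrite surj2S /bump leq0n add1n; ring.
Qed.

(** * Power moments of the dual code *)

Section PowerMoments.
Variables (F : finFieldType) (r : nat).
Hypotheses (hr : (0 < r)%N) (hF : #|F| = (2 ^ r)%N).
Local Notation lam := (@lam F r).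
Local Notation q := (2 ^ r)%N.
Variables (X : finType) (S : {set X}) (f : X -> F).

(* [wt a] is the weight of the word (tr (a * f g))_g of the dual code, and
   [num_codewords i] counts the words of weight i orthogonal to [f]. *)
Definition wt (a : F) : nat := #|[set g in S | lam (a * f g) != 1]|.

Definition num_codewords (i : nat) : nat :=
  #|[set A : {set X} | [&& A \subset S, #|A| == i & \sum_(g in A) f g == 0]]|.

Lemma two_wt (a : F) : 2 * (wt a)%:Z = #|S|%:Z - \sum_(g in S) lam (a * f g).
Proof.
transitivity (\sum_(g in S) (1 - lam (a * f g))); last first.
  by rewrite sumrB sumr_const natz.
rewrite (bigID (fun g => lam (a * f g) != 1)) /= addrC big1 ?add0r; last first.
  by move=> g /andP[_]; rewrite negbK => /eqP ->; rewrite subrr.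
rewrite (eq_bigr (fun _ => 2)) => [|g /andP[_]]; last first.
  by rewrite /Defs.lam; case: ifP.
rewrite sumr_const -[RHS]mulr_natr; congr (_ * _); rewrite natz; congr Posz.
by apply: eq_card => g; rewrite inE unfold_in.
Qed.

(** The factor [1 - lam (a * f g)] is 2 on the support of the word and 0 off it, so only the
    [t]-subsets of the support survive. *)
Lemma bin_wt (a : F) t :
  2 ^+ t * 'C(wt a, t)%:Z =
  \sum_(B : {set X} | (B \subset S) && (#|B| == t)) \prod_(g in B) (1 - lam (a * f g)).
Proof.
rewrite (bigID (fun B : {set X} => B \subset [set g in S | lam (a * f g) != 1])) /=.
rewrite addrC big1 ?add0r => [|B /andP[/andP[/subsetP BS _] /subsetPn[g gB]]]; last first.
  rewrite inE BS //= negbK => /eqP g1.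
  by rewrite (bigD1 g) //= g1 subrr mul0r.
rewrite (eq_bigr (fun _ => 2 ^+ t)) => [|B /andP[/andP[_ /eqP Bt] /subsetP hB]]; last first.
  rewrite (eq_bigr (fun _ => 2)) ?prodr_const ?Bt // => g /hB.
  by rewrite inE /Defs.lam; case: ifP; rewrite ?andbF.
rewrite sumr_const -[RHS]mulr_natr -cards_draws; congr (_ * _); rewrite natz; congr Posz.
apply: eq_card => B; rewrite inE unfold_in.
case: (boolP (B \subset [set _ in _ | _])) => [BW|]; last by rewrite andbF.
by rewrite andbT (subset_trans BW) //; apply/subsetP => g; rewrite inE => /andP[].
Qed.

(** Expanding the product over subsets of [B] and summing over [a] keeps exactly the subsets that
    are codewords. *)
Lemma sum_prod_lam (B : {set X}) :
  \sum_(a : F) \prod_(g in B) (1 - lam (a * f g)) =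
  q%:Z * \sum_(A : {set X} | (A \subset B) && (\sum_(g in A) f g == 0)) (-1) ^+ #|A|.
Proof.
under eq_bigr do rewrite prod_in_addr1.
rewrite exchange_big /= big_mkcondr /= mulr_sumr; apply: eq_bigr => A _.
transitivity (\sum_(a : F) (-1) ^+ #|A| * lam ((\sum_(g in A) f g) * a)).
  apply: eq_bigr => a _; rewrite prodrN -lam_sum //; congr (_ * lam _).
  by rewrite mulr_suml; apply: eq_bigr => g _; rewrite mulrC.
rewrite -mulr_sumr lam_orthogonal // mulrC.
by case: ifP; rewrite ?mulr0 ?mul0r.
Qed.

(** Pairs of a codeword [A] inside a [t]-set [B] are counted from [A]: a word of weight [i] lies in
    ['C(#|S| - i, t - i)] such sets. The guard excludes [t > #|S|], where truncated subtraction
    would turn the binomial into 1. *)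
Lemma sum_bin_wt t :
  \sum_(a : F) 2 ^+ t * 'C(wt a, t)%:Z =
  q%:Z * \sum_(i < #|S|.+1) (-1) ^+ i * (num_codewords i)%:Z *
     (if (i <= t <= #|S|)%N then 'C(#|S| - i, #|S| - t) else 0%N)%:Z.
Proof.
under eq_bigr do rewrite bin_wt.
rewrite exchange_big /=; under eq_bigr do rewrite sum_prod_lam.
rewrite -mulr_sumr; congr (_ * _).
rewrite (exchange_big_dep (fun A : {set X} => (A \subset S) && (\sum_(g in A) f g == 0))) /=;
  last first.
  by move=> B A /andP[BS _] /andP[AB ->]; rewrite (subset_trans AB BS).
rewrite (partition_big (fun A : {set X} => inord #|A| : 'I_#|S|.+1) xpredT) //=.
apply: eq_bigr => i _.
have inordE (A : {set X}) : A \subset S -> (inord #|A| == i) = (#|A| == i).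
  by move=> /subset_leq_card AS; rewrite -val_eqE /= inordK.
rewrite (eq_bigr (fun _ => (-1) ^+ i *
   (if (i <= t <= #|S|)%N then 'C(#|S| - i, #|S| - t) else 0%N)%:Z)) => [|A]; last first.
  move=> /andP[/andP[AS A0]]; rewrite inordE // => /eqP Ai.
  rewrite Ai A0 sumr_const -mulr_natr; congr (_ * _); rewrite natz; congr Posz.
  transitivity #|[set B : {set X} | [&& A \subset B, B \subset S & #|B| == t]]|.
    by apply: eq_card => B; rewrite inE unfold_in andbT andbC.
  rewrite card_between // Ai; case: leqP => //= it.
  have iS : (i <= #|S|)%N by rewrite -ltnS.
  case: leqP => tS; last by rewrite bin_small //; lia.
  by rewrite -bin_sub; [congr 'C(_, _)|]; lia.
rewrite sumr_const -[LHS]mulr_natr natz mulrAC; congr (_ * Posz _ * _);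
  apply: eq_card => A; rewrite inE unfold_in.
case AS : (A \subset S) => //=; rewrite inordE //; exact: andbC.
Qed.

(* Pless power moment identity; the dual words are indexed by a, that is,
   counted with multiplicity, so their being distinct is not needed. *)
Lemma pless_moment h :
  \sum_(a : F) (2 * (wt a)%:R) ^+ h =
  q%:R * \sum_(i < (minn #|S| h).+1) (-1) ^+ i * (num_codewords i)%:R *
    \sum_(i <= t < h.+1) t`!%:R * stirling2 h t * 2 ^+ (h - t) *
      (if (t <= #|S|)%N then 'C(#|S| - i, #|S| - t) else 0%N)%:R :> rat.
Proof.
set N := #|S|.
pose c i t := (if (i <= t <= N)%N then 'C(N - i, N - t) else 0%N)%:R : rat.
transitivity (\sum_(t < h.+1) surj2 h t * 2 ^+ (h - t) *
    (q%:R * \sum_(i < N.+1) (-1) ^+ i * (num_codewords i)%:R * c i t)).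
  transitivity (\sum_(t < h.+1) \sum_(a : F) surj2 h t * 2 ^+ (h - t)
    * (2 ^+ t * 'C(wt a, t)%:R)).
    rewrite exchange_big /=; apply: eq_bigr => a _.
    rewrite exprMn (expr_surj2 (wt a)) mulr_sumr; apply: eq_bigr => t _.
    have th : (t <= h)%N by rewrite -ltnS.
    by rewrite -{1}(subnK th) exprD; ring.
  apply: eq_bigr => t _; rewrite -mulr_sumr; congr (_ * _).
  have /(congr1 (fun z : int => z%:~R : rat)) := sum_bin_wt t.
  rewrite rmorphM rmorph_sum rmorph_sum /= => e.
  transitivity (\sum_(a : F) (2 ^+ t * 'C(wt a, t)%:Z)%:~R : rat).
    by apply: eq_bigr => a _; rewrite rmorphM rmorphXn.
  rewrite e; congr (_ * _); apply: eq_bigr => i _.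
  by rewrite !rmorphM rmorphXn rmorphN.
under eq_bigr do rewrite mulrCA.
rewrite -mulr_sumr; congr (_ * _).
under eq_bigr do rewrite mulr_sumr.
rewrite exchange_big /=.
(* Weights [i > h] drop out because every [t] is at most [h]. *)
rewrite (bigID (fun i : 'I_N.+1 => (i <= h)%N)) /= [X in _ + X]big1 ?addr0; last first.
  move=> i; rewrite -ltnNge => hi; apply: big1 => t _.
  by rewrite /c leqNgt (leq_trans (ltn_ord t)) // !mulr0.
have mN : ((minn N h).+1 <= N.+1)%N by rewrite ltnS geq_minl.
pose G i := \sum_(t < h.+1) surj2 h t * 2 ^+ (h - t) *
         ((-1) ^+ i * (num_codewords i)%:R * c i t).
transitivity (\sum_(i < (minn N h).+1) G i).
  rewrite (big_ord_widen _ G mN); apply: eq_bigl => i.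
  by have := ltn_ord i; rewrite !ltnS leq_min => ->.
apply: eq_bigr => i _; rewrite /G mulr_sumr.
have ih : (i <= h.+1)%N by have := ltn_ord i; rewrite ltnS leq_min => /andP[_ /leqW].
rewrite -(big_mkord xpredT (fun t => surj2 h t * 2 ^+ (h - t) *
         ((-1) ^+ i * (num_codewords i)%:R * c i t))) (big_cat_nat (leq0n i) ih) /=.
rewrite big_nat big1 ?add0r => [|t /andP[_ ti]]; last by rewrite /c leqNgt ti !mulr0.
rewrite big_nat [RHS]big_nat; apply: eq_bigr => t /andP[it _].
by rewrite fact_stirling2 /c it /=; ring.
Qed.

End PowerMoments.

(** * The moment recursion for Kloosterman sums *)

Unset Implicit Arguments.

Theorem theorem1 (F : finFieldType) (r s : nat) (hr : (0 < r)%N) (hs : (0 < s)%N)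
  (hF : #|F| = (2 ^ r)%N) :
  let n := (2 ^ s)%N in
  let q := (2 ^ r)%N in
  let P := (\prod_(2 <= j < n.+1) (q ^ j - 1))%N in
  let N := (q ^ 'C(n, 2) * P)%N in
  (forall h : nat, (0 < h)%N ->
     (q ^ ('C(n, 2) * h))%N%:R * (MK F r n.-1 h)%:~R
     = \sum_(i < h) (-1) ^+ (h + i + 1) * 'C(h, i)%:R * N%:R ^+ (h - i)
                      * (q ^ ('C(n, 2) * i))%N%:R * (MK F r n.-1 i)%:~R
       + q%:R * \sum_(i < (minn N h).+1)
                  (-1) ^+ (h + i) * (Cw F n i)%:R
                  * \sum_(i <= t < h.+1)
                      t`!%:R * stirling2 h t * 2 ^+ (h - t)
                      * (if (t <= N)%N then 'C(N - i, N - t) else 0%N)%:R :> rat)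
  /\ (forall b : F,
        (nbeta n b)%:Z
        = (q ^ ('C(n, 2) - 1))%N%:Z * (P%:Z + 1 + q%:Z * theta r n b))
  /\ (forall i : nat, (i <= N)%N ->
        Cw F n i
        = (\sum_(nu : {ffun F -> 'I_i.+1} |
                   ((\sum_(b : F) (nu b : nat))%N == i)
                   && ((\sum_(b : F) (b *+ nu b))%R == 0%R))
             \prod_(b : F) 'C(nbeta n b, nu b))%N).
Proof.
move=> n q P N.
have hn : n = (2 ^ s)%N by [].
have n1 : (1 < n)%N by rewrite -[1%N]/(2 ^ 0)%N ltn_exp2l.
split; last split; [|exact: (nbeta_Kloost hr hF hn n1)|by move=> i _; apply: Cw_fiberwise].
move=> h h0; pose f (g : 'M[F]_n) := \tr g; pose S := SLset F n.
have cardS : #|S| = N by rewrite card_SLset ?(ltnW n1) // hF.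
set RHS2 := (q%:R * _ : rat).
have pless : (-1) ^+ h * RHS2 = \sum_(a : F) (2 * (wt r S f a)%:R) ^+ h.
  rewrite (pless_moment hr hF) cardS -/q /RHS2 mulrCA; congr (_ * _).
  rewrite mulr_sumr; apply: eq_bigr => i _.
  by rewrite exprD !mulrA -expr2 sqrr_sign mul1r.
pose Q := (q ^ 'C(n, 2))%N.
have wtE a : a != 0 -> 2 * (wt r S f a)%:R = N%:R - Q%:R * (Kloost r n.-1 a)%:~R :> rat.
  move=> a0; have := two_wt r S f a.
  rewrite cardS (SL_lam_tr hr hF hn n1 a0) => /(congr1 (fun z : int => z%:~R : rat)).
  by rewrite rmorphB !rmorphM.
(* The zero word is the one index not covered by [wtE]; its [h]-th power vanishes because [h] is
   positive. *)
have wt0 : wt r S f 0 = 0%N.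
  apply/eqP; rewrite cards_eq0; apply/eqP/setP => g.
  by rewrite !inE mul0r lam0 eqxx andbF.
have expand : \sum_(a : F) (2 * (wt r S f a)%:R) ^+ h =
   \sum_(i < h.+1) (-1) ^+ i * 'C(h, i)%:R * N%:R ^+ (h - i) * (q ^ ('C(n, 2) * i))%N%:R
     * (MK F r n.-1 i)%:~R :> rat.
  rewrite (bigD1 0) //= wt0 mulr0 expr0n gtn_eqF // add0r.
  transitivity (\sum_(a : F | a != 0) \sum_(i < h.+1)
    (-1) ^+ i * 'C(h, i)%:R * N%:R ^+ (h - i) * (q ^ ('C(n, 2) * i))%N%:R
     * (Kloost r n.-1 a)%:~R ^+ i : rat).
    apply: eq_bigr => a a0; rewrite wtE // exprBn; apply: eq_bigr => i _.
    by rewrite -mulr_natr exprMn expnM natrX; ring.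
  rewrite exchange_big /=; apply: eq_bigr => i _.
  rewrite -mulr_sumr /MK rmorph_sum /=; congr (_ * _).
  by apply: eq_bigr => a _; rewrite rmorphXn.
(* The top term [i = h] of the binomial expansion is isolated: up to the sign [(-1) ^+ h] it is the
   left side of the recursion. *)
move: pless; rewrite expand big_ord_recr /= binn subnn expr0 !mulr1 => e.
have {}e : RHS2 = (-1) ^+ h * (\sum_(i < h) (-1) ^+ i * 'C(h, i)%:R * N%:R ^+ (h - i) *
   (q ^ ('C(n, 2) * i))%N%:R * (MK F r n.-1 i)%:~R) +
   (q ^ ('C(n, 2) * h))%N%:R * (MK F r n.-1 h)%:~R.
  rewrite -[LHS](signrMK h) e mulrDr; congr (_ + _).
  by rewrite -mulrA signrMK.
(* The lower moments cancel termwise, since [(-1) ^+ (h + i + 1)] is opposite to [(-1) ^+ h] times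
   [(-1) ^+ i]. *)
rewrite e addrA mulr_sumr -big_split /= big1 ?add0r // => i _.
by rewrite addn1 exprS exprD; ring.
Qed.
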